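(* Let $\mathbb K$ be a field of characteristic zero. The displacement polynomials satisfy, in the free associative algebra $\mathbb K\langle\mathbf X\rangle$, for all $n\in\mathbb N$, $$\mathcal P_n(X_1,\dots,X_n)=\sum_{i=1}^n(n-i+1)\cdot\mathcal P_{n-i}(X_1,\dots,X_{n-i})\cdot X_i .$$
   Context: $\mathbb K\langle\mathbf X\rangle$ is the free associative unital algebra (unit $I$) over $\mathbb K$ in noncommutative variables $X_1,X_2,\dots$. The displacement polynomials are $\mathcal P_0:=I$ and, for $i\in\mathbb N$, $\mathcal P_i(X_1,\dots,X_i)=\sum_{i_1+\cdots+i_k=i}p_{i_1,\dots,i_k}(i)\,X_{i_k}\cdots X_{i_1}$, where the sum runs over all $k\in\{1,\dots,i\}$ and all $(i_1,\dots,i_k)\in\mathbb N^k$ with sum $i$, and $p_{i_1,\dots,i_k}(t)=(t-i_1+1)(t-i_1-i_2+1)\cdots(t-i_1-\cdots-i_k+1)$. *)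

(* Defs.v *)
From mathcomp Require Import all_boot all_order all_algebra.
From mathcomp Require Import monalg.

Set Implicit Arguments.
Unset Strict Implicit.
Unset Printing Implicit Defensive.

Import GRing.Theory.
Local Open Scope ring_scope.

(* The free associative algebra K<X_1, X_2, ...>, as the monoid algebra over K
   of the free monoid on countably many letters. *)
Notation freeAlg K := {malg K[{fmonom nat}]}.

(* X_i is the letter i.-1, so that X_1, X_2, ... are exactly the free
   generators; only indices i >= 1 are meaningful. *)
Definition fvar (K : fieldType) (i : nat) : freeAlg K :=
  << fmu i.-1 >>.

(* p_{i_1,...,i_k}(t), for s = [:: i_1; ...; i_k]. *)
Definition dispCoef (K : fieldType) (s : seq nat) : {poly K} :=
  \prod_(1 <= j < (size s).+1) ('X - (sumn (take j s))%:R + 1).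

(* The k-tuples of positive integers with sum i have all parts at most i, so
   they are enumerated as k-tuples over 'I_i.+1. The case i = 0 is separate
   because the sum over k in {1, ..., 0} is 0. *)
Definition dispPoly (K : fieldType) (i : nat) : freeAlg K :=
  if i == 0%N then 1 else
  \sum_(1 <= k < i.+1)
    \sum_(u : k.-tuple 'I_i.+1 |
            all (fun a => 0 < a)%N (map val u) && (sumn (map val u) == i))
      (dispCoef K (map val u)).[i%:R] *: \prod_(a <- rev (map val u)) fvar K a.

(* Main.v *)
Require Import Defs.
From mathcomp Require Import all_boot all_order all_algebra.
From mathcomp Require Import monalg.

Import GRing.Theory.
Local Open Scope ring_scope.

(** Split off the first part [i_1] of a composition: its letter is the last one
    of the word, its factor [n - i_1 + 1] depends only on [n - i_1], and the
    remaining factors are those of the tail of the composition evaluated at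
    [n - i_1]. *)

(* The degree [k] part of [dispPoly K n]. Unlike the sums over
   tuples in [dispPoly], it involves no type depending on [n]. *)
Fixpoint dispPart (K : fieldType) (k n : nat) : freeAlg K :=
  if k is k'.+1 then
    \sum_(1 <= i < n.+1) (n - i + 1)%:R *: dispPart K k' (n - i) * fvar K i
  else (n == 0)%N%:R.

Lemma horner_dispCoef_cons (K : fieldType) (i n : nat) (s : seq nat) :
  (i <= n)%N ->
  (dispCoef K (i :: s)).[n%:R] =
    (n - i + 1)%:R * (dispCoef K s).[(n - i)%:R].
Proof.
move=> le_in; rewrite /dispCoef /= !horner_prod !big_add1 /=.
rewrite big_nat_recl //= take0 /= addn0; congr (_ * _).
  by rewrite !(hornerE, hornerMn) natrD natrB.
apply: eq_bigr => j _; rewrite !(hornerE, hornerMn) natrD natrB //.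
by rewrite opprD addrA.
Qed.

(** [P] and [F] act on plain sequences, so both sides can use them despite the different tuple
    lengths. *)
Lemma big_tuple_cons (R : nmodType) (T : finType) (k : nat)
    (P : pred (seq T)) (F : seq T -> R) :
  \sum_(u : k.+1.-tuple T | P u) F u =
  \sum_(x : T) \sum_(u : k.-tuple T | P (x :: u)) F (x :: u).
Proof.
rewrite pair_big_dep /=.
rewrite (reindex (fun xu : T * k.-tuple T => [tuple of xu.1 :: xu.2])) //=.
exists (fun u : k.+1.-tuple T => (thead u, [tuple of behead u])).
  by move=> [x u] _; congr (_, _) => //; apply: val_inj.
by move=> u _; rewrite [RHS]tuple_eta.
Qed.

(** The bound [N] is independent of [n]: the induction lowers [n] to [n - i] while the tail keeps
    its type over ['I_N]. *)
Lemma dispPart_sum_tuple (K : fieldType) (N k n : nat) : (n < N)%N ->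
  \sum_(u : k.-tuple 'I_N |
          all (fun a => 0 < a)%N (map val u) && (sumn (map val u) == n))
    (dispCoef K (map val u)).[n%:R] *: \prod_(a <- rev (map val u)) fvar K a
  = dispPart K k n.
Proof.
elim: k n => [|k IHk] n lt_nN.
  rewrite (eq_bigl (fun=> n == 0)%N) => [|u]; last by rewrite tuple0 /= eq_sym.
  rewrite big_mkcond (big_pred1 [tuple]) /= => [|u]; last exact/esym/eqP/tuple0.
  by case: eqP => // _; rewrite /dispCoef big_geq // big_nil hornerC scale1r.
rewrite (big_tuple_cons _ _ _
  (fun s => all (fun a => 0 < a)%N (map val s) && (sumn (map val s) == n))
  (fun s => (dispCoef K (map val s)).[n%:R] *:
              \prod_(a <- rev (map val s)) fvar K a)) /=.
(* The right side becomes a sum over all of ['I_N], zero outside [1 <= i <= n]. *)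
rewrite (big_nat_widen _ _ _ _ _ lt_nN) big_geq_mkord [RHS]big_mkcond /=.
apply: eq_bigr => i _.
case: ifP => [/andP[le_in i_gt0] | out_i]; last first.
  (* No composition of [n] starts with 0 or with a part exceeding [n]. *)
  rewrite big_pred0 // => u; apply/negP => /andP[/andP[i_gt0 _] /eqP sum_n].
  by move: out_i; rewrite i_gt0 ltnS -sum_n leq_addr.
rewrite -(IHk (n - i)%N) ?(leq_ltn_trans (leq_subr _ _)) //.
rewrite scaler_sumr mulr_suml; apply: eq_big => [u | u _].
  by rewrite i_gt0 /= -(eqn_add2l i (sumn _)) subnKC.
rewrite horner_dispCoef_cons // rev_cons -cats1 big_cat big_seq1 /=.
by rewrite scalerA scalerAl.
Qed.

(** Each of the [k] parts is at least 1, so their sum cannot be below [k]. *)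
Lemma dispPart_eq0 (K : fieldType) (k n : nat) :
  (n < k)%N -> dispPart K k n = 0.
Proof.
elim: k n => [//|k IHk] n lt_nk /=; apply: big1_seq => i /andP[_].
rewrite mem_index_iota => /andP[i_gt0 lt_in].
rewrite IHk ?scaler0 ?mul0r //.
by rewrite ltn_subLR // (leq_trans lt_nk) // -addn1 addnC leq_add2r.
Qed.

(** A free bound [N] lets all [dispPoly K (n - i)] share one range of [k], so that sums can be
    exchanged. *)
Lemma dispPoly_sum_dispPart (K : fieldType) (N n : nat) : (n < N)%N ->
  dispPoly K n = \sum_(0 <= k < N) dispPart K k n.
Proof.
move=> lt_nN; rewrite (big_cat_nat (n := n.+1)) //=.
rewrite [X in _ + X]big_nat_cond [X in _ + X]big1 ?addr0; last first.
  by move=> k /andP[/andP[lt_nk _] _]; apply: dispPart_eq0.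
(* The term [k = 0] is the indicator of [n = 0], matching the separate case of [dispPoly]. *)
rewrite big_nat_recl //= /dispPoly; case: eqP => [-> | _] /=.
  by rewrite big_geq // addr0.
rewrite add0r -(big_add1 _ _ 0 n.+1 xpredT (fun k => dispPart K k n)).
by apply: eq_bigr => k _; apply: dispPart_sum_tuple.
Qed.

Theorem theorem5p3 (K : fieldType) (charK : [pchar K] =i pred0)
    (n : nat) (n_gt0 : (0 < n)%N) :
  dispPoly K n =
  \sum_(1 <= i < n.+1) (n - i + 1)%:R *: dispPoly K (n - i) * fvar K i.
Proof.
(* Splitting off [k = 0], which vanishes as [n > 0], turns the bound [n.+2] into [n.+1], large
   enough for every [n - i]. *)
rewrite (dispPoly_sum_dispPart _ n.+2) // big_nat_recl //=.
rewrite (gtn_eqF n_gt0) add0r exchange_big /=; apply: eq_bigr => i _.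
rewrite (dispPoly_sum_dispPart _ n.+1) ?ltnS ?leq_subr //.
by rewrite scaler_sumr mulr_suml.
Qed.
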